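(* Let $\Bbbk$ be an algebraically closed field of arbitrary characteristic. A general smooth cubic surface over $\Bbbk$ can be defined, in appropriate coordinates $x_0,\ldots,x_3$ of $\mathbb{P}^3$, by the form $$\sum_{i=0}^3 x_i^3+\sum_{0\le i<j<k\le 3}a_{ijk}\,x_ix_jx_k,$$ where $a_{012},a_{013},a_{023},a_{123}\in\Bbbk$ are parameters.
   Context: ''General'' means: for all cubic surfaces in some nonempty Zariski open subset of the space of cubic surfaces in $\mathbb{P}^3$. *)

(* Defs.v *)
From HB Require Import structures.
From mathcomp Require Import all_boot all_order all_algebra.
From mathcomp Require Export mpoly.

Set Implicit Arguments.
Unset Strict Implicit.
Unset Printing Implicit Defensive.

Import GRing.Theory.

Local Open Scope ring_scope.

(* [dhomog n k d] is the vector space of forms of degree d in n variables.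
   A degree d hypersurface in P^(n-1), i.e. a point of P(dhomog n k d), is
   represented by a nonzero form, which it determines up to a nonzero scalar. *)

(* The elements of [basis n d] are the sorted d-tuples i_1 <= ... <= i_d of
   indices, corresponding bijectively (through [s2m]) to the monomials of
   degree d: there are 20 of them for n = 4 and d = 3. *)
Definition form_coef (k : fieldType) (n d : nat) (f : dhomog n k d)
    (t : 'I_#|basis n d|) : k :=
  (f : {mpoly k[n]})@_(s2m (enum_val t)).

(* Zariski open subsets of P(dhomog n k d): complements of the common zero loci
   of families of homogeneous polynomials in the coefficients of the form.  The
   value of U at the zero form, which is not a point, is irrelevant. *)
Definition zariski_open (k : fieldType) (n d : nat)
    (U : dhomog n k d -> Prop) : Prop :=
  exists S : {mpoly k[#|basis n d|]} -> Prop,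
    (forall D, S D -> exists e : nat, D \is e.-homog) /\
    (forall f : dhomog n k d, f != 0 ->
       (U f <-> exists2 D, S D & D.@[form_coef f] != 0)).

(* Jacobian criterion, meaningful over an algebraically closed field.  The
   condition f(x) = 0 is needed because Euler's formula does not recover it from
   the vanishing of the partial derivatives when the characteristic divides d. *)
Definition smooth_form (k : fieldType) (n d : nat) (f : dhomog n k d) : Prop :=
  forall x : 'I_n -> k, (exists i, x i != 0) ->
    (f : {mpoly k[n]}).@[x] = 0 ->
    exists i, ((f : {mpoly k[n]})^`M(i)).@[x] != 0.

Definition linear_subst (k : fieldType) (n : nat) (A : 'M[k]_n)
    (f : {mpoly k[n]}) : {mpoly k[n]} :=
  f \mPo [tuple \sum_(j < n) A i j *: 'X_j | i < n].

(* The hypersurface f = 0 is defined by the form g in some linear coordinates of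
   the projective space: two forms define the same hypersurface if and only if
   they are proportional, whence the scalar c. *)
Definition defined_in_some_coordinates_by (k : fieldType) (n : nat)
    (f g : {mpoly k[n]}) : Prop :=
  exists2 A : 'M[k]_n, A \in unitmx &
    exists2 c : k, c != 0 & linear_subst A f = c *: g.

(* Only the four values a i j l with i < j < l matter. *)
Definition normal_form (k : fieldType) (a : 'I_4 -> 'I_4 -> 'I_4 -> k) :
    {mpoly k[4]} :=
  \sum_(i < 4) 'X_i ^+ 3 +
  \sum_(i < 4) \sum_(j < 4 | (i < j)%N) \sum_(l < 4 | (j < l)%N)
    a i j l *: ('X_i * 'X_j * 'X_l).

(* Main.v *)
Require Import Defs.
From mathcomp Require Import all_boot all_order all_algebra.
From mathcomp Require Import closed_field ring.
Set Implicit Arguments.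
Unset Strict Implicit.
Unset Printing Implicit Defensive.
Import GRing.Theory.
Local Open Scope ring_scope.

(** Consider the family of all forms
      sum_i d_i l_i^3 + sum_(i<j<h) a_ijh l_i l_j l_h
    where the l_i are linear forms in four variables.  If the l_i are independent
    and no d_i vanishes, such a form is the normal form in the coordinates
    e_i l_i with e_i^3 = d_i ([cubic_normal_form]).  So it suffices to see that
    the forms with these two properties fill a nonempty Zariski open set, and that
    this open set contains a smooth form.

    The family is dominant because its differential is surjective at a suitable
    point ([tangent_form_full]).  The parameters d and a account for the cubes and
    for the squarefree monomials, and changes of coordinates must account for the
    monomials X_i^2 X_j.  In characteristic other than 3 they do so at the Fermat
    cubic, where X_i |-> X_i + t X_j contributes 3 X_i^2 X_j.  In characteristic 3
    this contribution is zero, and one uses instead the elementary symmetric form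
    e_3 of degree 3.  That surjectivity at a point implies dominance is proved
    without differentiating the relations, by looking at their lowest-order terms
    along arcs ([arcs_alg_indep]); this is insensitive to the characteristic.

    A dominant polynomial map of affine spaces over an algebraically closed field
    attains all values off some hypersurface D = 0 ([alg_indep_image]), by
    quantifier elimination.  As open sets are to be defined by homogeneous
    equations, D is replaced by one of its nonzero homogeneous parts: where that
    part does not vanish, some multiple of the form avoids D = 0
    ([meval_scale_neq0]), and forms count up to a scalar.

    Finally, a form that is singular somewhere has coefficients depending
    polynomially on too few parameters, so the singular forms lie in a
    hypersurface ([smooth_generic], from [alg_dependent]); a point off both
    hypersurfaces is a smooth form in the open set. *)

(** * Polynomial maps and algebraic independence *)

Lemma rmorph_mmap (R : nzRingType) (S T : comNzRingType) (g : {rmorphism S -> T})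
    (n : nat) (f : {rmorphism R -> S}) (h : 'I_n -> S) (p : {mpoly R[n]}) :
  g (mmap f h p) = mmap (g \o f) (g \o h) p.
Proof.
rewrite rmorph_sum; apply: eq_bigr => m _; rewrite rmorphM rmorph_prod.
by congr (_ * _); apply: eq_bigr => i _; rewrite rmorphXn.
Qed.

Lemma eq_mmap (R S : nzRingType) (n : nat) (f f' : R -> S) (h h' : 'I_n -> S) :
  f =1 f' -> h =1 h' -> mmap f h =1 mmap f' h'.
Proof.
move=> ef eh p; apply: eq_bigr => m _; rewrite ef; congr (_ * _).
by apply: eq_bigr => i _; rewrite eh.
Qed.

(** Both the lowest-order analysis along an arc and the passage from a point to
    its multiples rest on this one form of homogeneity. *)
Lemma mmap_homog_scale (R : nzRingType) (S : comNzRingType) (n : nat) (f : R -> S)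
    (s : S) (h : 'I_n -> S) (d : nat) (p : {mpoly R[n]}) :
  p \is d.-homog -> mmap f (fun i => s * h i) p = s ^+ d * mmap f h p.
Proof.
move=> /dhomogP hp; rewrite /mmap big_distrr big_seq [RHS]big_seq.
apply: eq_bigr => m /hp <-; rewrite /= mulrCA; congr (_ * _).
rewrite mdegE -prodrXr -big_split; apply: eq_bigr => i _.
by rewrite exprMn.
Qed.

(** Hence a nonzero polynomial stays nonzero when regarded as univariate in its
    last variable, which starts the induction step of the next lemma. *)
Lemma mwiden_muniK (R : comNzRingType) (n : nat) (p : {mpoly R[n.+1]}) :
  (map_poly (@mwiden n R) (muni p)).['X_ord_max] = p.
Proof.
pose g : {rmorphism _ -> _} := horner_eval 'X_ord_max \o map_poly (@mwiden n R).
rewrite [LHS](rmorph_mmap g (polyC \o @mpolyC n R)).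
rewrite -[RHS]comp_mpoly_id /comp_mpoly; apply: eq_mmap => [c|i] /=.
  by rewrite /horner_eval map_polyC hornerC /= mwidenC.
rewrite tnth_mktuple /horner_eval; case: splitP => j ij /=.
  rewrite map_polyC hornerC /= mwidenX mnmwiden1; congr 'X_[U_(_)].
  exact: val_inj.
rewrite map_polyX hornerX; congr 'X_[U_(_)]; apply: val_inj => /=.
by move: ij; rewrite /= ord1 addn0 => ->.
Qed.

(** Induction on the number of variables: a point where the leading coefficient
    in the last variable survives leaves a nonzero univariate polynomial, which
    has a nonroot because an algebraically closed field is infinite. *)
Lemma mpoly_nonroot (k : closedFieldType) (n : nat) (p : {mpoly k[n]}) :
  p != 0 -> exists x : 'I_n -> k, p.@[x] != 0.
Proof.
elim: n p => [|n IHn] p p0.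
  exists (fun=> 0); rewrite (nvar0_mpolyC p) mevalC.
  by apply: contraNneq p0 => p00; rewrite (nvar0_mpolyC p) p00 mpolyC0.
have: muni p != 0.
  apply: contraNneq p0 => u0.
  by rewrite -(mwiden_muniK p) u0 map_poly0 horner0.
rewrite -lead_coef_eq0 => /IHn[v vP].
have /closed_nonrootP[t tP] : map_poly (meval v) (muni p) != 0.
  apply: contraNneq vP => /(congr1 (fun q : {poly k} => q`_(size (muni p)).-1)).
  by rewrite coef_map coef0 => ->.
pose x (i : 'I_n.+1) := if split (cast_ord (esym (addn1 n)) i) is inl j then v j else t.
exists x; apply: contraNneq tP => px0; rewrite rootE -px0; apply/eqP.
pose g : {rmorphism _ -> _} := horner_eval t \o map_poly (meval v).
rewrite [LHS](rmorph_mmap g (polyC \o @mpolyC n k)); apply: eq_mmap => [c|i] /=.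
  by rewrite /horner_eval map_polyC hornerC /= mevalC.
rewrite /x /horner_eval; case: (split _) => j /=.
  by rewrite map_polyC hornerC /= mevalXU.
by rewrite map_polyX hornerX.
Qed.

Lemma pihomog_neq0 (R : nzRingType) (n : nat) (p : {mpoly R[n]}) :
  p != 0 -> exists e, pihomog mdeg e p != 0.
Proof.
move=> p0; have pE := pihomog_partitionE (leqnn (mmeasure mdeg p)).
suff /existsP[e eP] : [exists e : 'I_(mmeasure mdeg p), pihomog mdeg e p != 0].
  by exists e.
apply: contraR p0; rewrite negb_exists => /forallP h.
by rewrite pE big1 // => e _; apply/eqP; move: (h e); rewrite negbK.
Qed.

Definition alg_indep (k : fieldType) (n p : nat) (P : n.-tuple {mpoly k[p]}) :=
  forall D : {mpoly k[n]}, D \mPo P = 0 -> D = 0.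

(** A differential criterion for dominance that is valid in every characteristic.
    If D vanishes on the image of P, expand D at the point y0: its lowest
    homogeneous part E_e is nonzero, so E_e(w) is nonzero for some w.  Along an
    arc g whose image under P leaves y0 with velocity w, the polynomial D then
    vanishes to order exactly e, so it is not identically zero on the image.
    No derivative of D is taken, so p-th powers cause no trouble. *)
Lemma arcs_alg_indep (k : closedFieldType) (n p : nat)
    (P : n.-tuple {mpoly k[p]}) (y0 : 'I_n -> k) :
  (forall w : 'I_n -> k, exists g : 'I_p -> {poly k}, forall i,
     (mmap polyC g (tnth P i))`_0 = y0 i /\ (mmap polyC g (tnth P i))`_1 = w i) ->
  alg_indep P.
Proof.
move=> arcs D DP0; apply/eqP; apply: contraT => D0.
pose sh (y : 'I_n -> k) := [tuple 'X_i + (y i)%:MP_[n] | i < n].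
pose E := D \mPo sh y0.
have E0 : E != 0.
  have [x Dx] := mpoly_nonroot D0; apply: contraNneq Dx => E0.
  have := congr1 (meval (fun i => x i - y0 i)) E0.
  rewrite meval0 comp_mpoly_meval => <-; apply/eqP/meval_eq => i.
  by rewrite tnth_mktuple mevalD mevalXU mevalC subrK.
have [e Ee emin] : exists2 e, pihomog mdeg e E != 0 &
    forall d, (d < e)%N -> pihomog mdeg d E = 0.
  have ex := pihomog_neq0 E0.
  exists (ex_minn ex); case: ex_minnP => // m mP mmin d dm.
  by apply/eqP; apply: contraTT dm => /mmin; rewrite -leqNgt.
have [w wP] := mpoly_nonroot Ee.
have [g gP] := arcs w.
pose c i := mmap polyC g (tnth P i).
pose u i := drop_poly 1 (c i).
(* the image arc c is y0 + t u with u(0) = w *)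
have cE i : c i = (y0 i)%:P + 'X * u i.
  rewrite -[LHS](poly_take_drop 1) expr1 mulrC; congr (_ + _).
  apply/polyP => j; rewrite coef_take_poly coefC.
  by case: j => //=; have [] := gP i.
have Dc0 : mmap polyC c D = 0.
  rewrite -(rmorph0 (mmap polyC g)) -DP0 /comp_mpoly rmorph_mmap.
  by apply: eq_mmap => [a|i] //=; rewrite mmapC.
have DcE : mmap polyC c D = mmap polyC (fun i => 'X * u i) E.
  rewrite /E /comp_mpoly rmorph_mmap; apply: eq_mmap => [a|i] /=.
    by rewrite mmapC.
  by rewrite tnth_mktuple mmapD mmapC mmapX mmap1U cE addrC.
(* the coefficient of t^e in D(c) is the value of the e-th part at u(0) = w *)
have := Dc0; rewrite DcE (pihomog_partitionE (leq_addl e.+1 (mmeasure mdeg E))).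
rewrite -(big_mkord xpredT (fun d => pihomog mdeg d E)).
rewrite (@big_cat_nat _ _ _ e.+1) ?leq_addr //= big_nat_recr //=.
rewrite big_nat big1 ?add0r => [|d /andP[_ /emin] //].
rewrite rmorphD [X in _ + X]rmorph_sum /= (mmap_homog_scale _ _ _ (pihomogP _ _ _)) /=.
rewrite big_nat => /(congr1 (fun q : {poly k} => q`_e)).
rewrite coefD coef0 coefXnM ltnn subnn [X in _ + X]coef_sum.
rewrite [X in _ + X]big1 ?addr0 => [|d /andP[ed _]].
  move=> z; case/eqP: wP; rewrite -[RHS]z -[RHS]horner_coef0.
  rewrite [RHS](rmorph_mmap (horner_eval 0) polyC); apply: eq_mmap => [a|i] /=.
    by rewrite /horner_eval hornerC.
  by rewrite /horner_eval horner_coef0 coef_drop_poly; have [_ ->] := gP i.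
by rewrite (mmap_homog_scale _ _ _ (pihomogP _ _ _)) coefXnM ed.
Qed.

(** * Images of dominant maps *)

Lemma nth_map_enum_ord (V : nmodType) (n : nat) (y : 'I_n -> V) (i : 'I_n) :
  [seq y i | i <- enum 'I_n]`_i = y i.
Proof. by rewrite (nth_map i) ?size_enum_ord // nth_ord_enum. Qed.

(** The term uses the variables of index s, s + 1, ...: in the formula below the
    first n variables are kept for the coordinates in the target. *)
Definition term_of_mpoly (k : fieldType) (n s : nat) (p : {mpoly k[n]}) : GRing.term k :=
  \big[GRing.Add/GRing.NatConst k 0]_(m <- msupp p)
    GRing.Mul (GRing.Const p@_m)
      (\big[GRing.Mul/GRing.NatConst k 1]_(i < n) GRing.Exp (GRing.Var k (s + i)) (m i)).

Lemma eval_term_of_mpoly (k : fieldType) (n s : nat) (e : seq k) (p : {mpoly k[n]}) :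
  GRing.eval e (term_of_mpoly s p) = p.@[fun i => e`_(s + i)].
Proof.
rewrite mevalE (big_morph (GRing.eval e) (id1 := 0) (op1 := +%R)) //.
apply: eq_bigr => m _ /=; congr (_ * _).
by rewrite (big_morph (GRing.eval e) (id1 := 1) (op1 := *%R)).
Qed.

Lemma rterm_term_of_mpoly (k : fieldType) (n s : nat) (p : {mpoly k[n]}) :
  GRing.rterm (term_of_mpoly s p).
Proof.
apply: (big_ind (@GRing.rterm k)) => //= [x y -> -> //|m _].
by apply: (big_ind (@GRing.rterm k)) => //= x y -> ->.
Qed.

(** Quantifier elimination leaves no inverse in its output, so the value at an
    inverse is a mere default; so is 0 for the variables beyond the n-th, which
    the evaluation reads beyond the end of the list of values. *)
Fixpoint mpoly_of_term (k : fieldType) (n : nat) (t : GRing.term k) : {mpoly k[n]} :=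
  match t with
  | GRing.Var i => if insub i is Some j then 'X_j else 0
  | GRing.Const c => c%:MP
  | GRing.NatConst m => m%:R
  | GRing.Add t1 t2 => mpoly_of_term n t1 + mpoly_of_term n t2
  | GRing.Opp t1 => - mpoly_of_term n t1
  | GRing.NatMul t1 m => mpoly_of_term n t1 *+ m
  | GRing.Mul t1 t2 => mpoly_of_term n t1 * mpoly_of_term n t2
  | GRing.Inv _ => 0
  | GRing.Exp t1 m => mpoly_of_term n t1 ^+ m
  end.

Lemma meval_mpoly_of_term (k : fieldType) (n : nat) (y : 'I_n -> k) (t : GRing.term k) :
  GRing.rterm t -> (mpoly_of_term n t).@[y] = GRing.eval [seq y i | i <- enum 'I_n] t.
Proof.
elim: t => //=.
- move=> i _; case: insubP => [j _ ji|].
    by rewrite mevalXU -ji nth_map_enum_ord.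
  by rewrite -leqNgt => ni; rewrite meval0 nth_default // size_map size_enum_ord.
- by move=> c _; rewrite mevalC.
- by move=> m _; rewrite rmorph_nat.
- by move=> t1 IH1 t2 IH2 /andP[/IH1 <- /IH2 <-]; rewrite mevalD.
- by move=> t1 IH1 /IH1 <-; rewrite mevalN.
- by move=> t1 IH1 m /IH1 <-; rewrite mevalMn.
- by move=> t1 IH1 t2 IH2 /andP[/IH1 <- /IH2 <-]; rewrite mevalM.
- by move=> t1 IH1 m /IH1 <-; rewrite rmorphXn.
Qed.

(** Every atom is an equation q(y) = 0: where D collects all the q that are not
    the zero polynomial, each atom has a constant truth value as soon as D does
    not vanish. *)
Lemma qf_eval_generically_constant (k : fieldType) (n : nat) (f : GRing.formula k) :
  GRing.qf_form f -> GRing.rformula f ->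
  exists b, exists2 D : {mpoly k[n]}, D != 0 &
    forall y : 'I_n -> k, D.@[y] != 0 -> GRing.qf_eval [seq y i | i <- enum 'I_n] f = b.
Proof.
have two (f1 f2 : GRing.formula k) (op : bool -> bool -> bool) :
    (exists b, exists2 D : {mpoly k[n]}, D != 0 &
      forall y : 'I_n -> k, D.@[y] != 0 ->
        GRing.qf_eval [seq y i | i <- enum 'I_n] f1 = b) ->
    (exists b, exists2 D : {mpoly k[n]}, D != 0 &
      forall y : 'I_n -> k, D.@[y] != 0 ->
        GRing.qf_eval [seq y i | i <- enum 'I_n] f2 = b) ->
    exists b, exists2 D : {mpoly k[n]}, D != 0 &
      forall y : 'I_n -> k, D.@[y] != 0 ->
        op (GRing.qf_eval [seq y i | i <- enum 'I_n] f1)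
           (GRing.qf_eval [seq y i | i <- enum 'I_n] f2) = b.
  move=> [b1 [D1 D1_0 h1]] [b2 [D2 D2_0 h2]].
  exists (op b1 b2), (D1 * D2); first by rewrite mulf_neq0.
  by move=> y; rewrite mevalM mulf_eq0 negb_or => /andP[/h1 -> /h2 ->].
elim: f => //=.
- by move=> b _ _; exists b, 1 => [|y]; rewrite ?oner_neq0.
- move=> t1 t2 _ /andP[r1 r2].
  have ev (y : 'I_n -> k) :
      (GRing.eval [seq y i | i <- enum 'I_n] t1 ==
       GRing.eval [seq y i | i <- enum 'I_n] t2) =
      ((mpoly_of_term n t1 - mpoly_of_term n t2).@[y] == 0).
    by rewrite mevalB !meval_mpoly_of_term // subr_eq0.
  have [d0|d0] := eqVneq (mpoly_of_term n t1 - mpoly_of_term n t2) 0.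
    by exists true, 1 => [|y _]; rewrite ?oner_neq0 // ev d0 meval0 eqxx.
  by exists false; eexists; first exact: d0; move=> y /negbTE; rewrite ev.
- by move=> f1 I1 f2 I2 /andP[/I1 h1 /I2 h2] /andP[/h1 {}h1 /h2 {}h2]; apply: two.
- by move=> f1 I1 f2 I2 /andP[/I1 h1 /I2 h2] /andP[/h1 {}h1 /h2 {}h2]; apply: two.
- move=> f1 I1 f2 I2 /andP[/I1 h1 /I2 h2] /andP[/h1 {}h1 /h2 {}h2].
  exact: (two _ _ implb).
- move=> f1 I1 /I1 h1 /h1[b [D D0 h]].
  by exists (~~ b), D => // y /h ->.
Qed.

Lemma holds_big_and (R : unitRingType) (I : finType) (e : seq R)
    (f : I -> GRing.formula R) :
  GRing.holds e (\big[GRing.And/GRing.Bool true]_i f i) <->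
  forall i, GRing.holds e (f i).
Proof.
split=> [h i|h]; last by apply: big_ind => // f1 f2 h1 h2; split.
have := mem_index_enum i; elim: (index_enum I) h => // j r IHr.
rewrite big_cons inE => -[fj fr] /predU1P[->|/(IHr fr)] //.
Qed.

(** Chevalley's theorem for dominant polynomial maps between affine spaces.  The
    image of the open set H <> 0 is defined by a first-order formula, hence by
    quantifier elimination by a quantifier-free one, hence its membership is
    decided off a hypersurface D = 0: either the whole complement lies in the
    image, or none of it does.  In the second case D composed with P would vanish
    wherever H does not, contrary to algebraic independence. *)
Lemma alg_indep_image (k : closedFieldType) (n p : nat)
    (P : n.-tuple {mpoly k[p]}) (H : {mpoly k[p]}) :
  alg_indep P -> H != 0 ->
  exists2 D : {mpoly k[n]}, D != 0 &
    forall y : 'I_n -> k, D.@[y] != 0 ->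
      exists2 x : 'I_p -> k, H.@[x] != 0 & forall i, (tnth P i).@[x] = y i.
Proof.
move=> indP H0.
pose body : GRing.formula k := GRing.And
  (GRing.Not (GRing.Equal (term_of_mpoly n H) (GRing.NatConst k 0)))
  (\big[GRing.And/GRing.Bool true]_(i < n)
      GRing.Equal (term_of_mpoly n (tnth P i)) (GRing.Var k i)).
pose F := foldr (@GRing.Exists k) body (iota n p).
have bodyP e : GRing.holds e body <->
    H.@[fun i => e`_(n + i)] != 0 /\
    forall i, (tnth P i).@[fun j => e`_(n + j)] = e`_i.
  rewrite /body /= eval_term_of_mpoly holds_big_and.
  split=> -[/eqP h1 h2]; split=> // i; move: (h2 i);
    by rewrite /= eval_term_of_mpoly.
have FP (y : 'I_n -> k) : GRing.holds [seq y i | i <- enum 'I_n] F <->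
    exists2 x : 'I_p -> k, H.@[x] != 0 & forall i, (tnth P i).@[x] = y i.
  rewrite -GRing.foldExistsP; split=> [[e same /bodyP[h1 h2]]|[x h1 h2]].
    exists (fun i : 'I_p => e`_(n + i)) => // i; rewrite h2 -same.
      by rewrite nth_map_enum_ord.
    by rewrite !inE mem_iota negb_and -ltnNge ltn_ord.
  pose e := [seq y i | i <- enum 'I_n] ++ [seq x i | i <- enum 'I_p].
  have ex (i : 'I_p) : e`_(n + i) = x i.
    rewrite nth_cat size_map size_enum_ord ltnNge leq_addr /= addKn.
    by rewrite nth_map_enum_ord.
  have ey (i : 'I_n) : e`_i = y i.
    rewrite nth_cat size_map size_enum_ord ltn_ord.
    by rewrite nth_map_enum_ord.
  exists e => [i|].
    rewrite !inE mem_iota negb_and -ltnNge -leqNgt nth_cat size_map size_enum_ord.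
    case: (ltnP i n) => //= ni pi.
    rewrite [LHS]nth_default; last by rewrite size_map size_enum_ord.
    by rewrite [RHS]nth_default; last by rewrite size_map size_enum_ord leq_subRL.
  apply/bodyP; split=> [|i].
    by rewrite (meval_eq (v2 := x)).
  by rewrite (meval_eq (v2 := x)) // ey h2.
have rF : GRing.rformula F.
  rewrite /F; elim: (iota n p) => //=.
  rewrite !rterm_term_of_mpoly /=; apply: (big_ind (@GRing.rformula k)) => //=.
    by move=> f g -> ->.
  by move=> i _; rewrite rterm_term_of_mpoly.
have kP : GRing.closed_field_axiom k by exact: solve_monicpoly.
have wf := ClosedFieldQE.wf_ex_elim (F := k).
have ok := ClosedFieldQE.holds_ex_elim kP.
have /andP[qf rqf] := GRing.quantifier_elim_wf wf rF.
have [b [D D0 hD]] := qf_eval_generically_constant n qf rqf.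
have {}hD (y : 'I_n -> k) : D.@[y] != 0 ->
    reflect (exists2 x : 'I_p -> k, H.@[x] != 0 & forall i, (tnth P i).@[x] = y i) b.
  move=> /hD <-.
  by apply: (iffP (GRing.quantifier_elim_rformP wf ok _ rF)) => /FP.
exists D => // y Dy; apply/(hD y Dy).
have: (D \mPo P) * H != 0.
  by rewrite mulf_neq0 //; apply: contraNneq D0 => /indP ->.
move=> /mpoly_nonroot[x]; rewrite mevalM mulf_eq0 negb_or comp_mpoly_meval.
by move=> /andP[Dx Hx]; apply/(hD _ Dx); exists x.
Qed.

(** * Algebraic dependence *)

Lemma msize_mul_le (k : fieldType) (p a b : nat) (f g : {mpoly k[p]}) :
  (msize f <= a.+1 -> msize g <= b.+1 -> msize (f * g) <= (a + b).+1)%N.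
Proof.
have [->|f0] := eqVneq f 0; first by rewrite mul0r msize0.
have [->|g0] := eqVneq g 0; first by rewrite mulr0 msize0.
move=> fa gb; rewrite msizeM //.
by have := leq_add fa gb; rewrite addSn addnS; case: (_ + _)%N.
Qed.

Lemma msize_comp_mnm_le (k : fieldType) (n p e : nat)
    (P : n.-tuple {mpoly k[p]}) (m : 'X_{1..n}) :
  (forall i, msize (tnth P i) <= e.+1)%N ->
  (msize ('X_[m] \mPo P) <= (mdeg m * e).+1)%N.
Proof.
move=> Pe; rewrite comp_mpolyX mdegE big_distrl /=.
apply: (big_ind2 (fun f a => msize f <= a.+1)%N) => [|f a g b|i _].
- by rewrite msize1.
- exact: msize_mul_le.
elim: (m i) => [|d IHd]; first by rewrite expr0 msize1.
by rewrite exprS mulSn; apply: msize_mul_le.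
Qed.

(** Counting dimensions.  The d^n monomials of exponents less than d in n
    variables are sent by P to polynomials in p variables of degree less than
    N = O(d), which form a space of dimension at most N^p; as p < n, for large d
    there are more monomials than dimensions. *)
Lemma alg_dependent (k : fieldType) (n p : nat) (P : n.-tuple {mpoly k[p]}) :
  (p < n)%N -> exists2 D : {mpoly k[n]}, D != 0 & D \mPo P = 0.
Proof.
move=> pn; pose e := \max_(i < n) msize (tnth P i).
have Pe i : (msize (tnth P i) <= e.+1)%N by rewrite leqW // leq_bigmax.
(* with d = c^p + 1 one gets N^p = d^p c^p < d^(p+1) <= d^n *)
pose c := (n * e).+1; pose d := (c ^ p).+1; pose N := (d * c)%N.
pose mon (f : {ffun 'I_n -> 'I_d}) : 'X_{1..n} := [multinom val (f i) | i < n].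
have mon_inj : injective mon.
  move=> f g /mnmP fg; apply/ffunP => i; apply: val_inj.
  by have := fg i; rewrite !mnmE.
have mon_size f : (msize ('X_[mon f] \mPo P) <= N)%N.
  apply: leq_trans (msize_comp_mnm_le _ Pe) _.
  have fd : (mdeg (mon f) <= n * d.-1)%N.
    rewrite mdegE -[X in (_ <= X * _)%N]card_ord -sum_nat_const.
    by apply: leq_sum => i _; rewrite mnmE -ltnS ltn_ord.
  apply: (@leq_trans (n * d.-1 * e).+1); first by rewrite ltnS leq_mul.
  rewrite /N /c mulnS -add1n leq_add // -mulnA mulnCA.
  by rewrite leq_mul ?leq_pred.
pose box := {ffun 'I_p -> 'I_N}.
have box_card : (#|{: 'X_{1..p < N}}| <= N ^ p)%N.
  have mN (m : 'X_{1..p < N}) i : (m i < N)%N.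
    by apply: leq_ltn_trans (bmdeg m); rewrite mdegE (bigD1 i) ?leq_addr.
  pose h (m : 'X_{1..p < N}) : box := [ffun i => Ordinal (mN m i)].
  have h_inj : injective h.
    move=> m m' /ffunP mm'; apply: val_inj; apply/mnmP => i.
    by have := mm' i; rewrite !ffunE => -[].
  by have := leq_card h h_inj; rewrite card_ffun !card_ord.
have card_lt : (#|{: 'X_{1..p < N}}| < #|{ffun 'I_n -> 'I_d}|)%N.
  apply: leq_ltn_trans box_card _; rewrite card_ffun !card_ord /N expnMn.
  rewrite (leq_trans (n := d ^ p.+1)) ?leq_pexp2l // expnS mulnC.
  by rewrite ltn_pmul2r ?expn_gt0.
pose A := \matrix_(r < #|{ffun 'I_n -> 'I_d}|, s < #|{: 'X_{1..p < N}}|)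
  ('X_[mon (enum_val r)] \mPo P)@_(enum_val s : 'X_{1..p < N}).
have : ~~ row_free A.
  by rewrite -row_leq_rank -ltnNge (leq_ltn_trans (rank_leq_col A)).
rewrite -kermx_eq0 => /rowV0Pn[v /sub_kermxP vA v0].
pose D := \sum_r v 0 r *: 'X_[mon (enum_val r)].
exists D.
  have /rV0Pn[r vr] := v0.
  apply: contraNneq vr => D0; have := congr1 (mcoeff (mon (enum_val r))) D0.
  rewrite mcoeff0 raddf_sum (bigD1 r) //= mcoeffZ mcoeffX eqxx mulr1.
  rewrite big1 ?addr0 => [->//|s sr].
  rewrite mcoeffZ mcoeffX (inj_eq mon_inj) (inj_eq enum_val_inj).
  by rewrite (negPf sr) mulr0.
rewrite /D raddf_sum /=; apply/mpolyP => m; rewrite mcoeff0 raddf_sum /=.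
have [mN|Nm] := ltnP (mdeg m) N.
  have := congr1 (fun B : 'rV__ => B 0 (enum_rank (BMultinom mN))) vA.
  rewrite !mxE => vA0; rewrite -[RHS]vA0; apply: eq_bigr => r _.
  by rewrite linearZ /= mcoeffZ mxE enum_rankK.
apply: big1 => r _; rewrite linearZ /= mcoeffZ memN_msupp_eq0 ?mulr0 //.
by rewrite msize_mdeg_ge // (leq_trans (mon_size _)).
Qed.

(** * Forms and their coefficients *)

Definition basis_mnm (n d : nat) (t : 'I_#|basis n d|) : 'X_{1..n} :=
  s2m (enum_val t).

Lemma basis_mnm_inj (n d : nat) : injective (@basis_mnm n d).
Proof.
move=> t u tu; apply: enum_val_inj; apply: (@inj_s2m n d) tu; exact: enum_valP.
Qed.

Lemma mdeg_basis_mnm (n d : nat) (t : 'I_#|basis n d|) : mdeg (basis_mnm t) = d.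
Proof.
apply/eqP; rewrite basis_cover; apply/mapP; exists (enum_val t) => //.
by rewrite mem_enum enum_valP.
Qed.

Lemma basis_mnm_surj (n d : nat) (m : 'X_{1..n}) :
  mdeg m = d -> exists t : 'I_#|basis n d|, basis_mnm t = m.
Proof.
move=> /eqP; rewrite basis_cover => /mapP[s]; rewrite mem_enum => sb ->.
by exists (enum_rank_in sb s); rewrite /basis_mnm enum_rankK_in.
Qed.

Lemma form_coefE (k : fieldType) (n d : nat) (f : dhomog n k d) :
  (f : {mpoly k[n]}) = \sum_t form_coef f t *: 'X_[basis_mnm t].
Proof.
apply/mpolyP => m; rewrite raddf_sum /=.
have [/basis_mnm_surj[t <-]|md] := eqVneq (mdeg m) d.
  rewrite (bigD1 t) //= mcoeffZ mcoeffX eqxx mulr1 big1 ?addr0 // => u ut.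
  by rewrite mcoeffZ mcoeffX (inj_eq (@basis_mnm_inj _ _)) (negPf ut) mulr0.
rewrite (dhomog_nemf_coeff (dhomog_is_dhomog f)) // big1 // => t _.
rewrite mcoeffZ mcoeffX; case: eqP => [tm|]; last by rewrite mulr0.
by rewrite -tm mdeg_basis_mnm eqxx in md.
Qed.

Lemma form_of_coef (k : fieldType) (n d : nat) (y : 'I_#|basis n d| -> k) :
  exists f : dhomog n k d, form_coef f =1 y.
Proof.
pose p := \sum_t y t *: 'X_[basis_mnm t].
have hp : p \is d.-homog.
  by apply: rpred_sum => t _; apply: rpredZ; rewrite dhomogX /= mdeg_basis_mnm.
exists (DHomog hp) => t; rewrite /form_coef /= raddf_sum (bigD1 t) //=.
rewrite mcoeffZ mcoeffX eqxx mulr1 big1 ?addr0 // => u ut.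
by rewrite mcoeffZ mcoeffX (inj_eq (@basis_mnm_inj _ _)) (negPf ut) mulr0.
Qed.

Lemma mderiv_homog (k : fieldType) (n d : nat) (i : 'I_n) (p : {mpoly k[n]}) :
  p \is d.+1.-homog -> p^`M(i) \is d.-homog.
Proof.
move=> hp; apply/dhomogP => m; rewrite mcoeff_msupp mcoeff_mderiv => pm.
have : p@_(m + U_(i)) != 0 by apply: contraNneq pm => ->; rewrite mul0rn.
rewrite -mcoeff_msupp => /(dhomog_mf hp) /eqP.
by rewrite /= mdegD mdeg1 addn1 eqSS => /eqP.
Qed.

(** * Singular forms lie in a hypersurface *)

Section SingularAt.
Variables (k : fieldType) (n d : nat) (c : 'I_n).

Local Notation N := #|basis n d.+1|.

(* If x_c = 1, the equations f(x) = 0 and (df/dx_i)(x) = 0 for i != c express the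
   coefficients of the n monomials X_c^d X_i through x and the other
   coefficients: the matrix of this linear system is unitriangular. *)
Let special (i : 'I_n) : 'X_{1..n} := (U_(c) *+ d + U_(i))%MM.

Let special_inj : injective special.
Proof. by move=> i j /addmI /eqP; rewrite eq_mnm1 => /eqP. Qed.

Let is_special (t : 'I_N) := [exists i, basis_mnm t == special i].

(* The free parameters are the other coefficients of f and the coordinates x_i,
   i != c. *)
Let T : finType := ({t : 'I_N | ~~ is_special t} + {i | i != c})%type.

(* n coefficients are replaced by n - 1 coordinates *)
Let card_T : (#|T| < N)%N.
Proof.
have [u uP] : exists u : 'I_n -> 'I_N, forall i, basis_mnm (u i) = special i.
  apply: (fin_all_exists (P := fun i t => basis_mnm t = special i)) => i.
  by apply: basis_mnm_surj; rewrite mdegD mdegMn !mdeg1 mul1n addn1.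
have u_inj : injective u.
  by move=> i j ij; apply: special_inj; rewrite -!uP ij.
rewrite card_sum !card_sig /= -[X in (_ < X)%N]card_ord -(cardC is_special).
rewrite addnC ltn_add2r.
have -> : #|[pred i | i != c]| = #|'I_n|.-1 by rewrite -(cardC1 c); apply: eq_card.
rewrite prednK; last by rewrite card_ord; case: (n) c => // -[].
rewrite -(card_codom u_inj); apply/subset_leq_card/subsetP => _ /codomP[i ->].
by apply/existsP; exists i; rewrite uP.
Qed.

Let zv (t : 'I_N) : {mpoly k[#|T|]} :=
  if insub t is Some s then 'X_(enum_rank (inl s : T)) else 0.

Let xv : n.-tuple {mpoly k[#|T|]} :=
  [tuple if insub i is Some j then 'X_(enum_rank (inr j : T)) else 1 | i < n].

(* For g the identity or a partial derivative: the value at x of g applied to the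
   part of f that does not involve the special monomials. *)
Let restv (g : {mpoly k[n]} -> {mpoly k[n]}) : {mpoly k[#|T|]} :=
  \sum_t zv t * (g 'X_[basis_mnm t] \mPo xv).

(* The coefficients of f as polynomials in the parameters. *)
Let psi : N.-tuple {mpoly k[#|T|]} :=
  [tuple zv t
    - \sum_(i | i != c) restv (mderiv i) *
        ((basis_mnm t == special i)%:R - tnth xv i * (basis_mnm t == special c)%:R)
    - restv idfun * (basis_mnm t == special c)%:R | t < N].

(** The forms with a singular point in the affine chart x_c = 1 are the image of a
    space of dimension one less than that of all forms, so their coefficients
    satisfy a nontrivial polynomial relation. *)
Lemma singular_at_hypersurface :
  exists2 D : {mpoly k[N]}, D != 0 &
    forall (f : dhomog n k d.+1) (x : 'I_n -> k), x c = 1 ->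
      (f : {mpoly k[n]}).@[x] = 0 ->
      (forall i, ((f : {mpoly k[n]})^`M(i)).@[x] = 0) ->
      D.@[form_coef f] = 0.
Proof.
have [D D0 DP] := alg_dependent psi card_T.
exists D => // f x xc fx dfx.
pose v (r : 'I_#|T|) : k :=
  match (enum_val r : T) with inl s => form_coef f (val s) | inr j => x (val j) end.
suffices psiE t : (tnth psi t).@[v] = form_coef f t.
  by rewrite -(meval_eq _ psiE) -comp_mpoly_meval DP meval0.
pose a (t : 'I_N) := if is_special t then 0 else form_coef f t.
have zvE u : (zv u).@[v] = a u.
  rewrite /zv /a; case: insubP => [s us su|].
    by rewrite mevalXU /v enum_rankK su (negPf us).
  by rewrite negbK => ->; rewrite meval0.
have xvE i : (tnth xv i).@[v] = x i.
  rewrite tnth_mktuple; case: insubP => [j _ ji|].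
    by rewrite mevalXU /v enum_rankK ji.
  by rewrite negbK => /eqP ->; rewrite meval1 xc.
pose rest := \sum_t a t *: 'X_[basis_mnm t].
have restE (g : {linear {mpoly k[n]} -> {mpoly k[n]}}) :
    (restv g).@[v] = (g rest).@[x].
  rewrite /restv /rest (linear_sum g) !rmorph_sum; apply: eq_bigr => u _ /=.
  rewrite mevalM zvE comp_mpoly_meval (meval_eq _ xvE).
  by rewrite linearZ mevalZ.
have [u uP] : exists u : 'I_n -> 'I_N, forall i, basis_mnm (u i) = special i.
  apply: (fin_all_exists (P := fun i t => basis_mnm t = special i)) => i.
  by apply: basis_mnm_surj; rewrite mdegD mdegMn !mdeg1 mul1n addn1.
have fE : (f : {mpoly k[n]}) =
    rest + \sum_i form_coef f (u i) *: 'X_[special i].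
  rewrite [LHS]form_coefE (bigID is_special) /= addrC; congr (_ + _).
    rewrite /rest [RHS](bigID is_special) /= [X in _ = X + _]big1 ?add0r => [|s ss].
      by apply: eq_bigr => s /negPf ss; rewrite /a ss.
    by rewrite /a ss scale0r.
  rewrite (reindex u) /=.
    apply: eq_big => [i|i _]; last by rewrite uP.
    by apply/existsP; exists i; rewrite uP.
  pose u' (t : 'I_N) := odflt c [pick i | basis_mnm t == special i].
  exists u' => s.
    move=> _; rewrite /u' uP; case: pickP => [i /eqP /special_inj ->//|/(_ s)].
    by rewrite eqxx.
  rewrite inE => /existsP[i si]; rewrite /u'; case: pickP => [j /eqP sj|/(_ i)].
    by apply: basis_mnm_inj; rewrite uP.
  by rewrite si.
have spx i : ('X_[special i] : {mpoly k[n]}).@[x] = x i.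
  by rewrite mpolyXD mevalM mevalXU -mpolyXn rmorphXn /= mevalXU xc expr1n mul1r.
have dspx i j : i != c -> (('X_[special j] : {mpoly k[n]})^`M(i)).@[x] = (j == i)%:R.
  move=> ic; rewrite mderivX /special mnmDE mulmnE !mnm1E.
  rewrite [c == i]eq_sym (negPf ic) mul0n add0n.
  have [<-|_] := eqVneq j i; last by rewrite scale0r meval0.
  by rewrite scale1r addmK -mpolyXn rmorphXn /= mevalXU xc expr1n.
have R0 : (restv idfun).@[v] = - \sum_j form_coef f (u j) * x j.
  move: fx; rewrite (restE idfun) fE mevalD [X in _ + X]rmorph_sum /=.
  move/eqP; rewrite addr_eq0 => /eqP ->; congr (- _).
  by apply: eq_bigr => j _; rewrite mevalZ spx.
have Ri i : i != c -> (restv (mderiv i)).@[v] = - form_coef f (u i).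
  move=> ic; move: (dfx i); rewrite (restE (mderiv i)) fE mderivD mevalD.
  rewrite [X in _ + X.@[_]]linear_sum [X in _ + X]rmorph_sum /=.
  move/eqP; rewrite addr_eq0 => /eqP ->; congr (- _).
  rewrite (bigD1 i) //= mderivZ mevalZ dspx // eqxx mulr1.
  rewrite big1 ?addr0 // => j ji.
  by rewrite mderivZ mevalZ dspx // (negPf ji) mulr0.
have natE (b : bool) : (b%:R : {mpoly k[#|T|]}).@[v] = b%:R by rewrite rmorph_nat.
rewrite tnth_mktuple !mevalB mevalM natE zvE R0 rmorph_sum /=.
under eq_bigr => i ic.
  rewrite mevalM mevalB mevalM !natE xvE Ri //; over.
have [/existsP[j /eqP tj]|nt] := boolP (is_special t); last first.
  have nsp i : (basis_mnm t == special i) = false.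
    by apply: contraNF nt => ti; apply/existsP; exists i.
  rewrite big1 => [|i _]; rewrite !nsp !mulr0 ?subrr ?mulr0 //.
  by rewrite !subr0 /a (negPf nt).
have -> : t = u j by apply: basis_mnm_inj; rewrite uP.
rewrite /a; have -> : is_special (u j) by apply/existsP; exists j; rewrite uP.
rewrite sub0r uP !(inj_eq special_inj).
have [->|jc] := eqVneq j c.
  rewrite mulr1 opprK [X in _ + X](bigD1 c) //= xc mulr1 addrCA -[RHS]addr0.
  congr (_ + _).
  apply/eqP; rewrite addrC subr_eq0; apply/eqP/eq_bigr => i ic.
  by rewrite (inj_eq special_inj) eq_sym (negPf ic) sub0r mulr1 mulrNN.
rewrite mulr0 subr0 (bigD1 j) //= !(inj_eq special_inj) eqxx mulr0 subr0 mulr1.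
rewrite big1 ?addr0 ?opprK // => i /andP[_ ij].
by rewrite (inj_eq special_inj) eq_sym (negPf ij) mulr0 subr0 mulr0.
Qed.

End SingularAt.

(** A singular point can be rescaled into one of the charts x_c = 1; multiply the
    relations obtained for all c. *)
Lemma smooth_generic (k : fieldType) (n d : nat) :
  exists2 D : {mpoly k[#|basis n d.+1|]}, D != 0 &
    forall f : dhomog n k d.+1, D.@[form_coef f] != 0 -> smooth_form f.
Proof.
have /fin_all_exists[D DP] (c : 'I_n) :
    exists D : {mpoly k[#|basis n d.+1|]}, D != 0 /\
      forall (f : dhomog n k d.+1) (x : 'I_n -> k), x c = 1 ->
        (f : {mpoly k[n]}).@[x] = 0 ->
        (forall i, ((f : {mpoly k[n]})^`M(i)).@[x] = 0) ->
        D.@[form_coef f] = 0.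
  by have [D D0 DP] := singular_at_hypersurface k d c; exists D.
exists (\prod_c D c); first by apply/prodf_neq0 => c _; have [] := DP c.
move=> f; rewrite rmorph_prod => /prodf_neq0 Df x [c xc] fx.
apply/existsP; apply: contraT; rewrite negb_exists => /forallP dfx.
have [_ Dsing] := DP c; have /eqP[] := Df c isT.
apply: (Dsing f (fun i => (x c)^-1 * x i)) => [||i]; first exact: mulVf.
  by rewrite /meval (mmap_homog_scale _ _ _ (dhomog_is_dhomog f)) -/(meval _ _) fx mulr0.
rewrite /meval (mmap_homog_scale _ _ _ (mderiv_homog _ (dhomog_is_dhomog f))).
by move: (dfx i); rewrite negbK -/(meval _ _) => /eqP ->; rewrite mulr0.
Qed.

(** * The family of cubic forms and its differential *)

Section Cubic.
Variable B : comNzRingType.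
Implicit Types (d l n : 'I_4 -> B) (a b : 'I_4 -> 'I_4 -> 'I_4 -> B).

Definition cubic d a l : B :=
  \sum_(i < 4) d i * l i ^+ 3 +
  \sum_(i < 4) \sum_(j < 4 | (i < j)%N) \sum_(h < 4 | (j < h)%N)
    a i j h * (l i * l j * l h).

(** The differential of [cubic] at (d, a, l), applied to the tangent vector
    (d', a', l'). *)
Definition dcubic d a l d' a' l' : B :=
  \sum_(i < 4) (d' i * l i ^+ 3 + d i * (l i ^+ 2 * l' i *+ 3)) +
  \sum_(i < 4) \sum_(j < 4 | (i < j)%N) \sum_(h < 4 | (j < h)%N)
    (a' i j h * (l i * l j * l h) +
     a i j h * (l' i * l j * l h + l i * l' j * l h + l i * l j * l' h)).

Lemma eq_cubic d d' l l' a a' :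
  d =1 d' -> (forall i j h, a i j h = a' i j h) -> l =1 l' ->
  cubic d a l = cubic d' a' l'.
Proof.
move=> dd aa ll; rewrite /cubic; congr (_ + _).
  by apply: eq_bigr => i _; rewrite dd ll.
do 3!apply: eq_bigr => ? _.
by rewrite aa !ll.
Qed.

Lemma eq_dcubic d d' l l' e e' m m' a a' b b' :
  d =1 d' -> (forall i j h, a i j h = a' i j h) -> l =1 l' ->
  e =1 e' -> (forall i j h, b i j h = b' i j h) -> m =1 m' ->
  dcubic d a l e b m = dcubic d' a' l' e' b' m'.
Proof.
move=> dd aa ll ee bb mm; rewrite /dcubic; congr (_ + _).
  by apply: eq_bigr => i _; rewrite dd ee ll mm.
do 3!apply: eq_bigr => ? _.
by rewrite aa bb !ll !mm.
Qed.

Lemma dcubic_linear d a l c d1 a1 l1 d2 a2 l2 :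
  dcubic d a l (fun i => c * d1 i + d2 i) (fun i j h => c * a1 i j h + a2 i j h)
    (fun i => c * l1 i + l2 i) =
  c * dcubic d a l d1 a1 l1 + dcubic d a l d2 a2 l2.
Proof.
rewrite /dcubic mulrDr !mulr_sumr [RHS]addrACA.
congr (_ + _); rewrite -!big_split; apply: eq_bigr => i _ /=; first by ring.
rewrite !mulr_sumr -!big_split; apply: eq_bigr => j _ /=.
by rewrite !mulr_sumr -!big_split; apply: eq_bigr => h _ /=; ring.
Qed.

Lemma cubic_taylor d a l d' a' l' (e : B) :
  exists r, cubic (fun i => d i + e * d' i) (fun i j h => a i j h + e * a' i j h)
      (fun i => l i + e * l' i) =
    cubic d a l + e * dcubic d a l d' a' l' + e ^+ 2 * r.
Proof.
pose r1 i := 3 * d' i * l i ^+ 2 * l' i + 3 * d i * l i * l' i ^+ 2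
  + e * (d i * l' i ^+ 3 + 3 * d' i * l i * l' i ^+ 2) + e ^+ 2 * d' i * l' i ^+ 3.
pose r2 i j h :=
  a' i j h * (l' i * l j * l h + l i * l' j * l h + l i * l j * l' h) +
  (a i j h + e * a' i j h) *
    (l i * l' j * l' h + l' i * l j * l' h + l' i * l' j * l h + e * l' i * l' j * l' h).
exists (\sum_i r1 i +
  \sum_(i < 4) \sum_(j < 4 | (i < j)%N) \sum_(h < 4 | (j < h)%N) r2 i j h).
rewrite /cubic /dcubic !mulrDr !mulr_sumr [X in _ = X + _]addrACA [RHS]addrACA.
congr (_ + _); rewrite -!big_split; apply: eq_bigr => i _ /=.
  by rewrite /r1; ring.
rewrite !mulr_sumr -!big_split; apply: eq_bigr => j _ /=.
rewrite !mulr_sumr -!big_split; apply: eq_bigr => h _ /=.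
by rewrite /r2; ring.
Qed.
End Cubic.

Local Notation i0 := (@Ordinal 4 0 isT).
Local Notation i1 := (@Ordinal 4 1 isT).
Local Notation i2 := (@Ordinal 4 2 isT).
Local Notation i3 := (@Ordinal 4 3 isT).

Lemma big_ord4 (V : nmodType) (F : 'I_4 -> V) :
  \sum_i F i = F i0 + F i1 + F i2 + F i3.
Proof.
rewrite !big_ord_recr big_ord0 /= add0r.
by congr (F _ + F _ + F _ + F _); apply: val_inj.
Qed.

Lemma big_triples4 (V : nmodType) (F : 'I_4 -> 'I_4 -> 'I_4 -> V) :
  \sum_(i < 4) \sum_(j < 4 | (i < j)%N) \sum_(h < 4 | (j < h)%N) F i j h =
  F i0 i1 i2 + F i0 i1 i3 + F i0 i2 i3 + F i1 i2 i3.
Proof.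
under eq_bigr => i _ do
  (rewrite big_mkcond /=; under eq_bigr => j _ do rewrite big_mkcond /=).
by rewrite !big_ord4 /= ?big_ord4 /= !(addr0, add0r).
Qed.

Section Tangent.
Variables (k : fieldType) (d0 a0 : k).

Definition tangent_form (d' : 'I_4 -> k) (a' : 'I_4 -> 'I_4 -> 'I_4 -> k)
    (N : 'I_4 -> 'I_4 -> k) : {mpoly k[4]} :=
  dcubic (fun=> d0%:MP) (fun _ _ _ => a0%:MP) (fun i => 'X_i)
    (fun i => (d' i)%:MP) (fun i j h => (a' i j h)%:MP)
    (fun i => \sum_j N i j *: 'X_j).

(** The tangent vectors to the family of all forms [cubic], in all coordinates, at
    the form with constant parameters d0 and a0 in the standard coordinates. *)
Definition tangent (W : {mpoly k[4]}) :=
  exists d' a' N, tangent_form d' a' N = W.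

Lemma tangent_lin c V W : tangent V -> tangent W -> tangent (c *: V + W).
Proof.
move=> [d1 [a1 [N1 <-]]] [d2 [a2 [N2 <-]]].
exists (fun i => c * d1 i + d2 i), (fun i j h => c * a1 i j h + a2 i j h),
  (fun i j => c * N1 i j + N2 i j).
rewrite -mul_mpolyC -dcubic_linear; apply: eq_dcubic => [||i|i|i j h|i] //=.
- by rewrite mpolyCD mpolyCM.
- by rewrite mpolyCD mpolyCM.
rewrite mulr_sumr -big_split; apply: eq_bigr => j _ /=.
by rewrite mul_mpolyC scalerA -scalerDl.
Qed.

Lemma tangent0 : tangent 0.
Proof.
exists (fun=> 0), (fun _ _ _ => 0), (fun _ _ => 0).
rewrite /tangent_form /dcubic !big_triples4 !big_ord4 !scale0r mpolyC0.
by ring.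
Qed.

Lemma tangent_scale c W : tangent W -> tangent (c *: W).
Proof. by move=> tW; have := tangent_lin c tW tangent0; rewrite addr0. Qed.

Lemma tangent_cube i : tangent ('X_i ^+ 3).
Proof.
exists (fun j => (j == i)%:R), (fun _ _ _ => 0), (fun _ _ => 0).
rewrite /tangent_form /dcubic !big_triples4 !big_ord4 !scale0r !mpolyC0.
by case: i => [[|[|[|[|//]]]] ?]; rewrite !eqE /= ?mpolyC0 ?mpolyC1; ring.
Qed.

Lemma tangent_squarefree (i j h : 'I_4) :
  (i < j)%N -> (j < h)%N -> tangent ('X_i * 'X_j * 'X_h).
Proof.
move=> ij jh.
exists (fun=> 0), (fun i' j' h' => [&& i' == i, j' == j & h' == h]%:R), (fun _ _ => 0).
rewrite /tangent_form /dcubic !big_triples4 !big_ord4 !scale0r !mpolyC0.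
case: i ij => [[|[|[|[|//]]]] ?]; case: j jh => [[|[|[|[|//]]]] ?] //;
case: h => [[|[|[|[|//]]]] ?] //.
all: by move=> ? ?; rewrite !eqE /= ?mpolyC0 ?mpolyC1; ring.
Qed.
End Tangent.

(** At the Fermat cubic, moving the i-th coordinate in the direction of X_j gives
    3 X_i^2 X_j. *)
Lemma tangent_square_char_neq3 (k : fieldType) (i j : 'I_4) :
  3%:R != 0 :> k -> tangent 1 0 ('X_i ^+ 2 * 'X_j : {mpoly k[4]}).
Proof.
move=> n3.
have -> : 'X_i ^+ 2 * 'X_j = 3%:R^-1 *: ('X_i ^+ 2 * 'X_j *+ 3) :> {mpoly k[4]}.
  by rewrite -scaler_nat scalerA mulVf // scale1r.
apply: tangent_scale.
exists (fun=> 0), (fun _ _ _ => 0), (fun r s => ((r == i) && (s == j))%:R).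
rewrite /tangent_form /dcubic !big_triples4 !big_ord4 -!mul_mpolyC !mpolyC0.
by case: i => [[|[|[|[|//]]]] ?]; case: j => [[|[|[|[|//]]]] ?];
   rewrite !eqE /= ?mpolyC0 ?mpolyC1; ring.
Qed.

(** In characteristic 3 coordinate changes do not move the Fermat cubic to first
    order, and the base point is the cubic e_3, the elementary symmetric form.
    For r != i, moving the r-th coordinate in the direction of X_i gives X_i times
    the sum of the products X_s X_u over s, u != r.  Taking this with coefficient
    1 for r = j and -1 for the two remaining r cancels the square terms other than
    X_i^2 X_j, which gets the coefficient -2 = 1; squarefree terms are absorbed
    by the directions a'. *)
Lemma tangent_square_char3 (k : fieldType) (i j : 'I_4) :
  3%:R = 0 :> k -> i != j -> tangent 0 1 ('X_i ^+ 2 * 'X_j : {mpoly k[4]}).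
Proof.
move=> k3 ij.
have -> : 'X_i ^+ 2 * 'X_j = - ('X_i ^+ 2 * 'X_j *+ 2) :> {mpoly k[4]}.
  by apply/eqP; rewrite -addr_eq0 -mulrS -scaler_nat k3 scale0r.
exists (fun=> 0),
  (fun p q s => if i \in [:: p; q; s] then if j \in [:: p; q; s] then 1 else -1 else 0),
  (fun r s => if (s == i) && (r != i) then if r == j then 1 else -1 else 0).
rewrite /tangent_form /dcubic !big_triples4 !big_ord4 -!mul_mpolyC.
by case: i ij => [[|[|[|[|//]]]] ?]; case: j => [[|[|[|[|//]]]] ?] //= _;
   rewrite ?inE ?eqE /= ?mpolyCN ?mpolyC0 ?mpolyC1; ring.
Qed.

(** * Dominance of the family *)

Lemma basis3_mnmX (k : fieldType) (n : nat) (t : 'I_#|basis n 3|) :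
  exists i j h : 'I_n, [/\ (i <= j)%N, (j <= h)%N &
    'X_[basis_mnm t] = 'X_i * 'X_j * 'X_h :> {mpoly k[n]}].
Proof.
rewrite /basis_mnm; move: (enum_valP t); case: (enum_val t).
case=> [|i [|j [|h [|? ?]]]] //= sz; rewrite inE /= => /and3P[ij jh _].
exists i, j, h; split=> //; rewrite -!mpolyXD; congr 'X_[_].
by apply/mnmP => u; rewrite !mnmE /= addn0 addnA.
Qed.

(** Every monomial of degree 3 is a cube, a square times another variable, or
    squarefree. *)
Lemma tangent_form_full (k : fieldType) : exists d0 a0 : k,
  forall w : 'I_#|basis 4 3| -> k, tangent d0 a0 (\sum_t w t *: 'X_[basis_mnm t]).
Proof.
have [d0 [a0 sq]] : exists d0 a0 : k,
    forall i j : 'I_4, i != j -> tangent d0 a0 ('X_i ^+ 2 * 'X_j).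
  have [k3|k3] := eqVneq (3%:R : k) 0.
    by exists 0, 1 => i j; apply: tangent_square_char3.
  by exists 1, 0 => i j _; apply: tangent_square_char_neq3.
exists d0, a0 => w; elim/big_rec: _ => [|t W _]; first exact: tangent0.
apply: tangent_lin; have [i [j [h [+ + ->]]]] := basis3_mnmX k t.
rewrite leq_eqVlt => /orP[/eqP/val_inj <-|ij]; rewrite leq_eqVlt.
  move=> /orP[/eqP/val_inj <-|ih]; first by rewrite -expr2 -exprSr; apply: tangent_cube.
  by rewrite -expr2; apply: sq; rewrite neq_ltn ih.
move=> /orP[/eqP/val_inj <-|jh]; last exact: tangent_squarefree.
by rewrite -mulrA mulrC -expr2; apply: sq; rewrite neq_ltn ij orbT.
Qed.

Section Functoriality.
Variables (B C : comNzRingType) (f : {rmorphism B -> C}).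

Lemma rmorph_cubic d a l :
  f (cubic d a l) = cubic (f \o d) (fun i j h => f (a i j h)) (f \o l).
Proof.
rewrite /cubic rmorphD !rmorph_sum; congr (_ + _); apply: eq_bigr => i _.
  by rewrite rmorphM rmorphXn.
rewrite rmorph_sum; apply: eq_bigr => j _.
by rewrite rmorph_sum; apply: eq_bigr => h _; rewrite !rmorphM.
Qed.

Lemma rmorph_dcubic d a l d' a' l' :
  f (dcubic d a l d' a' l') =
  dcubic (f \o d) (fun i j h => f (a i j h)) (f \o l)
    (f \o d') (fun i j h => f (a' i j h)) (f \o l').
Proof.
rewrite /dcubic rmorphD !rmorph_sum; congr (_ + _); apply: eq_bigr => i _.
  by rewrite rmorphD !rmorphM rmorphMn rmorphM !rmorphXn.
rewrite rmorph_sum; apply: eq_bigr => j _.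
by rewrite rmorph_sum; apply: eq_bigr => h _; rewrite !(rmorphD, rmorphM).
Qed.
End Functoriality.

(** The summands index the matrix of the linear forms, the coefficients of the
    cubes and those of the products. *)
Definition params : finType := (('I_4 * 'I_4) + ('I_4 + 'I_4 * 'I_4 * 'I_4))%type.

Definition cubic_of_params (R : comNzRingType) (p : params -> R) : {mpoly R[4]} :=
  cubic (fun i => (p (inr (inl i)))%:MP) (fun i j h => (p (inr (inr (i, j, h))))%:MP)
    (fun i => \sum_j p (inl (i, j)) *: 'X_j).

Lemma map_cubic_of_params (R S : comNzRingType) (f : {rmorphism R -> S}) p :
  map_mpoly f (cubic_of_params p) = cubic_of_params (f \o p).
Proof.
rewrite /cubic_of_params rmorph_cubic; apply: eq_cubic => [i|i j h|i] /=;
  rewrite ?map_mpolyC //.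
by rewrite rmorph_sum; apply: eq_bigr => j _ /=; rewrite map_mpolyZ map_mpolyX.
Qed.

Definition coef_of_params (k : fieldType) :
    #|basis 4 3|.-tuple {mpoly k[#|params|]} :=
  [tuple (cubic_of_params (fun r => 'X_(enum_rank r)))@_(basis_mnm t)
    | t < #|basis 4 3|].

Lemma mmap_coef_of_params (k : fieldType) (R : comNzRingType) (f : {rmorphism k -> R})
    (h : 'I_#|params| -> R) t :
  mmap f h (tnth (coef_of_params k) t) =
  (cubic_of_params (h \o enum_rank))@_(basis_mnm t).
Proof.
rewrite tnth_mktuple.
have -> : cubic_of_params (h \o enum_rank) =
    map_mpoly (mmap f h) (cubic_of_params (fun r => 'X_(enum_rank r) : {mpoly k[_]})).
  rewrite map_cubic_of_params; apply: eq_cubic => [i|i j l|i] /=.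
  - by rewrite mmapX mmap1U.
  - by rewrite mmapX mmap1U.
  - by apply: eq_bigr => j _; rewrite mmapX mmap1U.
by rewrite mcoeff_map_mpoly.
Qed.

Lemma mcoeff_first_order (k : fieldType) (n : nat) (F W : {mpoly k[n]})
    (r : {mpoly {poly k}[n]}) (m : 'X_{1..n}) (p : {mpoly {poly k}[n]}) :
  p = map_mpoly polyC F + 'X%:MP * map_mpoly polyC W + 'X%:MP ^+ 2 * r ->
  (p@_m)`_0 = F@_m /\ (p@_m)`_1 = W@_m.
Proof.
move=> ->; rewrite -rmorphXn 2!mcoeffD 2!mcoeffCM 2!mcoeff_map_mpoly /=.
by rewrite !coefD !coefC !coefXM !coefXnM /= !coefC /= !addr0 add0r.
Qed.

(** The family of all forms [cubic] is dominant: by surjectivity of the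
    differential at the base point, a straight line in the parameter space gives
    an arc with any prescribed velocity. *)
Lemma alg_indep_coef_of_params (k : closedFieldType) : alg_indep (coef_of_params k).
Proof.
have [d0 [a0 full]] := tangent_form_full k.
pose base : {mpoly k[4]} :=
  cubic (fun=> d0%:MP) (fun _ _ _ => a0%:MP) (fun i => 'X_i).
apply: (@arcs_alg_indep _ _ _ _ (fun t => base@_(basis_mnm t))) => w.
have [d' [a' [N NE]]] := full w.
pose g (r : params) : {poly k} := match r with
  | inl (i, j) => ((i == j)%:R)%:P + 'X * (N i j)%:P
  | inr (inl i) => d0%:P + 'X * (d' i)%:P
  | inr (inr (i, j, h)) => a0%:P + 'X * (a' i j h)%:P
  end.
exists (g \o enum_val) => t; rewrite mmap_coef_of_params.
have [r rE] := cubic_taylor (fun=> (d0%:P)%:MP) (fun _ _ _ => (a0%:P)%:MP)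
  (fun i : 'I_4 => 'X_i : {mpoly {poly k}[4]}) (fun i => ((d' i)%:P)%:MP)
  (fun i j h => ((a' i j h)%:P)%:MP) (fun i => \sum_j (N i j)%:P *: 'X_j) 'X%:MP.
have baseE : map_mpoly polyC base =
    cubic (fun=> (d0%:P)%:MP) (fun _ _ _ => (a0%:P)%:MP) (fun i => 'X_i).
  rewrite rmorph_cubic.
  by apply: eq_cubic => [i|i j h|i] /=; rewrite ?map_mpolyC ?map_mpolyX.
have velE : map_mpoly polyC (tangent_form d0 a0 d' a' N) =
    dcubic (fun=> (d0%:P)%:MP) (fun _ _ _ => (a0%:P)%:MP) (fun i => 'X_i)
      (fun i => ((d' i)%:P)%:MP) (fun i j h => ((a' i j h)%:P)%:MP)
      (fun i => \sum_j (N i j)%:P *: 'X_j).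
  rewrite rmorph_dcubic.
  apply: eq_dcubic => [i|i j h|i|i|i j h|i] /=; rewrite ?map_mpolyC ?map_mpolyX //.
  by rewrite rmorph_sum; apply: eq_bigr => j _ /=; rewrite map_mpolyZ map_mpolyX.
have [|-> ->] := @mcoeff_first_order k 4 base (tangent_form d0 a0 d' a' N) r
    (basis_mnm t) (cubic_of_params ((g \o enum_val) \o enum_rank)); last first.
  split=> //; rewrite NE raddf_sum (bigD1 t) //= mcoeffZ mcoeffX eqxx mulr1.
  rewrite big1 ?addr0 // => u ut.
  by rewrite mcoeffZ mcoeffX (inj_eq (@basis_mnm_inj _ _)) (negPf ut) mulr0.
rewrite baseE velE -rE; apply: eq_cubic => [i|i j h|i] /=;
  rewrite ?enum_rankK /= ?mpolyCD ?mpolyCM //.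
rewrite mulr_sumr; under eq_bigr do rewrite enum_rankK /= scalerDl -scalerA.
rewrite big_split /=; congr (_ + _).
  rewrite (bigD1 i) //= eqxx scale1r big1 ?addr0 // => j ji.
  by rewrite eq_sym (negPf ji) scale0r.
by apply: eq_bigr => j _; rewrite mul_mpolyC.
Qed.

(** * The normal form *)

(** A homogeneous part of D detects when some multiple of y avoids D = 0: the map
    c |-> D(c y) is a polynomial whose coefficients are the values at y of the
    homogeneous parts. *)
Lemma meval_scale_neq0 (k : closedFieldType) (n e : nat) (D : {mpoly k[n]})
    (y : 'I_n -> k) :
  (pihomog mdeg e D).@[y] != 0 ->
  exists2 c : k, c != 0 & D.@[fun i => c * y i] != 0.
Proof.
move=> ey; set N := mmeasure mdeg D.
pose q : {poly k} := \poly_(i < N) (pihomog mdeg i D).@[y].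
have qE c : q.[c] = D.@[fun i => c * y i].
  rewrite horner_poly [in RHS](pihomog_partitionE (leqnn N)) rmorph_sum /=.
  apply: eq_bigr => i _.
  by rewrite [RHS](mmap_homog_scale _ _ _ (pihomogP _ _ _)) mulrC.
have q0 : q != 0.
  apply: contraNneq ey => /(congr1 (fun q : {poly k} => q`_e)).
  rewrite coef0 coef_poly => /eqP; case: ltnP => // Ne _; apply/eqP.
  rewrite /pihomog big_seq_cond big1 ?meval0 // => m /andP[mD /eqP me].
  by have := mmeasure_mnm_lt mdeg mD; rewrite me ltnNge Ne.
have /closed_nonrootP[c] : 'X * q != 0 by rewrite mulf_neq0 ?polyX_eq0.
rewrite rootE hornerM hornerX mulf_eq0 negb_or => /andP[c0 qc].
by exists c; rewrite // -qE.
Qed.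

(** Absorb cube roots of the coefficients of the cubes into the coordinates. *)
Lemma cubic_normal_form (k : closedFieldType) (f : {mpoly k[4]}) (c : k)
    (d : 'I_4 -> k) (a : 'I_4 -> 'I_4 -> 'I_4 -> k) (M : 'M[k]_4) :
  c != 0 -> (forall i, d i != 0) -> M \in unitmx ->
  c *: f = cubic (fun i => (d i)%:MP) (fun i j h => (a i j h)%:MP)
             (fun i => \sum_j M i j *: 'X_j) ->
  exists a', defined_in_some_coordinates_by f (normal_form a').
Proof.
move=> c0 d0 uM fE.
have /fin_all_exists[e eP] i : exists e, e ^+ 3 = d i.
  have /closed_rootP[e] : size ('X^3 - (d i)%:P) != 1%N by rewrite size_XnsubC.
  by rewrite rootE !hornerE subr_eq0 => /eqP; exists e.
have e0 i : e i != 0.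
  by apply: contraNneq (d0 i) => ei; rewrite -eP ei expr0n.
pose E := diag_mx (\row_i e i).
have uE : E \in unitmx.
  by rewrite unitmxE det_diag unitfE; apply/prodf_neq0 => i _; rewrite mxE.
pose A := invmx (E *m M).
have MA i h : \sum_j M i j * A j h = (e i)^-1 * (i == h)%:R.
  apply: (mulfI (e0 i)); rewrite mulrA mulfV // mul1r.
  have := congr1 (fun B : 'M_4 => B i h) (mulmxV (_ : E *m M \in unitmx)).
  rewrite unitmx_mul uE uM => /(_ isT); rewrite -mulmxA mul_diag_mx !mxE.
  by move=> <-.
exists (fun i j h => a i j h / (e i * e j * e h)), A.
  by rewrite unitmx_inv unitmx_mul uE.
exists c^-1; first by rewrite invr_eq0.
rewrite -[f](scalerK c0) fE /linear_subst linearZ /=; congr (_ *: _).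
have lE i : (\sum_j M i j *: 'X_j) \mPo [tuple \sum_(j < 4) A i j *: 'X_j | i < 4]
    = (e i)^-1 *: 'X_i :> {mpoly k[4]}.
  rewrite linear_sum /=.
  under eq_bigr => j _ do
    rewrite linearZ /= comp_mpolyXU -tnth_nth tnth_mktuple scaler_sumr.
  rewrite exchange_big /=.
  under eq_bigr => h _ do
    (under eq_bigr => j _ do rewrite scalerA; rewrite -scaler_suml MA).
  rewrite (bigD1 i) //= eqxx mulr1 big1 ?addr0 // => h hi.
  by rewrite eq_sym (negPf hi) mulr0 scale0r.
rewrite rmorph_cubic /cubic /normal_form; congr (_ + _).
  apply: eq_bigr => i _ /=; rewrite comp_mpolyC lE exprZn mul_mpolyC scalerA.
  by rewrite -eP exprVn mulfV ?scale1r // expf_neq0.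
do 3!apply: eq_bigr => ? _; rewrite /= comp_mpolyC !lE.
rewrite -!(scalerAl, scalerAr) !scalerA mul_mpolyC scalerA; congr (_ *: _).
by rewrite !invfM; ring.
Qed.

Lemma cubic_of_params_homog (k : fieldType) (p : params -> k) :
  cubic_of_params p \is 3.-homog.
Proof.
have lP i : (\sum_j p (inl (i, j)) *: 'X_j : {mpoly k[4]}) \is 1.-homog.
  by apply: rpred_sum => j _; apply: rpredZ; rewrite dhomogX /= mdeg1.
apply: rpredD; apply: rpred_sum => i _.
  by rewrite mul_mpolyC; apply: rpredZ; apply: (dhomogMn 3 (lP i)).
apply: rpred_sum => j _; apply: rpred_sum => h _; rewrite mul_mpolyC.
exact/rpredZ/(dhomogM (dhomogM (lP i) (lP j)) (lP h)).
Qed.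

Definition nondegeneracy (k : fieldType) : {mpoly k[#|params|]} :=
  \det (\matrix_(i < 4, j < 4) 'X_(enum_rank (inl (i, j) : params))) *
  \prod_(i < 4) 'X_(enum_rank (inr (inl i) : params)).

Lemma meval_nondegeneracy (k : fieldType) (x : 'I_#|params| -> k) :
  (nondegeneracy k).@[x] =
  \det (\matrix_(i < 4, j < 4) x (enum_rank (inl (i, j) : params))) *
  \prod_(i < 4) x (enum_rank (inr (inl i) : params)).
Proof.
rewrite mevalM rmorph_prod -det_map_mx; congr (\det _ * _).
  by apply/matrixP => i j; rewrite !mxE /= mevalXU.
by apply: eq_bigr => i _ /=; rewrite mevalXU.
Qed.

Lemma nondegeneracy_neq0 (k : fieldType) : nondegeneracy k != 0.
Proof.
pose p (r : params) : k := match r with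
  | inl (i, j) => (i == j)%:R | inr _ => 1 end.
apply/eqP => /(congr1 (meval (p \o enum_val))); apply/eqP.
rewrite meval0 meval_nondegeneracy.
rewrite (_ : \matrix_(i, j) _ = 1%:M); last first.
  by apply/matrixP => i j; rewrite !mxE /= enum_rankK.
by rewrite det1 mul1r; apply/prodf_neq0 => i _; rewrite /= enum_rankK oner_neq0.
Qed.

Theorem theorem6p3 (k : closedFieldType) :
  exists U : dhomog 4 k 3 -> Prop,
    [/\ zariski_open U,
        exists f : dhomog 4 k 3, [/\ f != 0, U f & smooth_form f]
      & forall f : dhomog 4 k 3, f != 0 -> U f -> smooth_form f ->
          exists a : 'I_4 -> 'I_4 -> 'I_4 -> k,
            defined_in_some_coordinates_by f (normal_form a)].
Proof.
have [D D0 DP] :=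
  alg_indep_image (@alg_indep_coef_of_params k) (nondegeneracy_neq0 k).
have [e De] := pihomog_neq0 D0.
have [S S0 SP] := smooth_generic k 4 2.
exists (fun f => (pihomog mdeg e D).@[form_coef f] != 0); split.
- exists (eq (pihomog mdeg e D)); split=> [_ <-|f _]; first by exists e; apply: pihomogP.
  by split=> [|[_ <-//]]; exists (pihomog mdeg e D).
- have /mpoly_nonroot[y] : pihomog mdeg e D * S != 0 by rewrite mulf_neq0.
  rewrite mevalM mulf_eq0 negb_or => /andP[Dy Sy].
  have [f fy] := form_of_coef y; exists f.
  have smf : smooth_form f by apply: SP; rewrite (meval_eq _ fy).
  split=> //; last by rewrite (meval_eq _ fy).
  apply/eqP => f0; have [||i] := smf (fun=> 1).
  + by exists ord0; rewrite oner_neq0.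
  + by rewrite f0 meval0.
  by rewrite f0 mderiv0 meval0 eqxx.
move=> f _ /meval_scale_neq0[c c0 /DP[x]] + + _.
rewrite meval_nondegeneracy mulf_eq0 negb_or => /andP[xM xd] xE.
pose p := x \o (@enum_rank params).
apply: (@cubic_normal_form k f c (fun i => p (inr (inl i)))
  (fun i j h => p (inr (inr (i, j, h)))) (\matrix_(i, j) p (inl (i, j)))) => //.
- by move=> i; move/prodf_neq0: xd; apply.
- by rewrite unitmxE unitfE.
transitivity (cubic_of_params p); last first.
  by apply: eq_cubic => // i; apply: eq_bigr => j _; rewrite mxE.
have cf (t : 'I_#|basis 4 3|) : (c *: (f : {mpoly k[4]}))@_(basis_mnm t) =
    (cubic_of_params p)@_(basis_mnm t).
  by rewrite mcoeffZ; have := xE t; rewrite [LHS]mmap_coef_of_params => ->.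
rewrite (form_coefE f) -[RHS]/(DHomog (cubic_of_params_homog p) : {mpoly k[4]}).
rewrite form_coefE scaler_sumr; apply: eq_bigr => t _.
by rewrite scalerA; congr (_ *: _); rewrite -[RHS]cf mcoeffZ.
Qed.
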